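(* Let $S$ be a closed surface and let $G$ be an $S$-grid with nonempty curvature sequence $L$. Let $G_L$ be the graph whose vertices are the curvature vertices of $G$, with one edge joining $u$ and $v$ for each transverse $uv$-walk in $G$, and immerse $G_L$ transversely in $S$ by drawing each edge along its corresponding transverse walk (so that $G$ contains a subdivision of $\widehat{G_L}$ as a subgraph, whose subdivided edges are the transverse walks of $G$). Then the embedded graph $\widehat{G_L}$ is an $S$-grid.
   Context: An $S$-grid is a graph embedded in the closed surface $S$ such that every facial boundary walk has length four (equivalently, the topological dual graph is $4$-regular). A curvature vertex is a vertex of degree different from $4$; the curvature sequence of $G$ is its degree sequence with all $4$'s removed. At a degree-$4$ vertex with incident edge-ends $e_1,e_2,e_3,e_4$ in rotational order, $e_i$ and $e_{i+2}$ are called transverse. A transverse walk is a $uv$-walk (possibly $u=v$) with $u,v$ not of degree $4$, all internal vertices of degree $4$ in $G$, and each pair of successive edges transverse at the vertex between them. A transverse immersion of a graph $H$ in $S$ is an immersion whose only self-intersections are transverse crossings of edge segments; $\widehat{H}$ denotes the graph embedded in $S$ obtained by placing a vertex at each transverse crossing. *)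

(* Defs.v *)
From HB Require Import structures.
From mathcomp Require Import all_boot all_order all_algebra.
From mathcomp Require Import boolp.

Set Implicit Arguments.
Unset Strict Implicit.
Unset Printing Implicit Defensive.

Local Open Scope nat_scope.

(* Graphs (loops and parallel edges allowed) cellularly embedded in a closed
   surface, orientable or not, are encoded by their flags: a flag is a mutually
   incident (vertex, edge, face) triple, and t0, t1, t2 change respectively the
   vertex, the edge, the face of a flag, keeping the two other components.
   Vertices, edges and faces are then the orbits of <t1, t2>, <t0, t2> and
   <t0, t1>.  Since every edge has exactly four flags, only the embedding of an
   isolated vertex in the sphere, which has no face of length 4, is not
   represented. *)
Record embedded_graph := EmbeddedGraph {
  flag :> finType;
  t0 : flag -> flag;
  t1 : flag -> flag;
  t2 : flag -> flag;
  t0K : involutive t0;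
  t1K : involutive t1;
  t2K : involutive t2;
  t0_neq : forall x, t0 x != x;
  t1_neq : forall x, t1 x != x;
  t2_neq : forall x, t2 x != x;
  t02C : forall x, t0 (t2 x) = t2 (t0 x);
  t02_neq : forall x, t0 x != t2 x
}.

Definition cell (T : finType) (a b : T -> T) (x : T) : {set T} :=
  [set y | connect [rel y z | (z == a y) || (z == b y)] x y].

Definition cells (T : finType) (a b : T -> T) : {set {set T}} :=
  [set cell a b x | x : T].

Section EmbeddedGraph.
Variable G : embedded_graph.
Implicit Types (x y z : G) (u v : {set G}) (d : {set G}) (w : seq {set G}).

Definition vertex x : {set G} := cell (@t1 G) (@t2 G) x.
Definition vertices : {set {set G}} := cells (@t1 G) (@t2 G).
Definition edges : {set {set G}} := cells (@t0 G) (@t2 G).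
Definition faces : {set {set G}} := cells (@t0 G) (@t1 G).

Definition edge_end x : {set G} := [set x; t2 x].
Definition degree v : nat := #|[set edge_end x | x in v]|.

Definition rho x : G := t1 (t2 x).

(* t1 \o t0 steps along one edge of the boundary of the face of x. *)
Definition face_length x : nat := order (fun y => t1 (t0 y)) x.

Definition connected_graph : Prop :=
  forall x y, connect [rel y z | [|| z == t0 y, z == t1 y | z == t2 y]] x y.

Definition euler_char : int :=
  (#|vertices|%:Z - #|edges|%:Z + #|faces|%:Z)%R.

Definition orientable_graph : Prop :=
  exists c : G -> bool,
    forall x, [/\ c (t0 x) = ~~ c x, c (t1 x) = ~~ c x & c (t2 x) = ~~ c x].

Definition degree_sequence : seq nat := [seq degree v | v <- enum vertices].
Definition curvature_sequence : seq nat := [seq k <- degree_sequence | k != 4].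
Definition curvature_vertices : {set {set G}} :=
  [set v in vertices | degree v != 4].

Definition transverse d d' : bool :=
  [exists x, [&& degree (vertex x) == 4, d == edge_end x
               & d' == edge_end (rho (rho x))]].

(* A walk is the sequence of the edges it traverses, each given by the
   edge-end at which it is entered; it is left at the other edge-end. *)
Definition other_end d : {set G} := [set t0 x | x in d].
Definition origin d : {set G} := \bigcup_(x in d) vertex x.

Definition transverse_walk u v w : bool :=
  if w is d :: w' then
    [&& all [in [set edge_end x | x : G]] w,
        u == origin d, v == origin (other_end (last d w')),
        degree u != 4, degree v != 4
      & path (fun d1 d2 => transverse (other_end d1) d2) d w']
  else false.

Definition rev_walk w : seq {set G} := rev [seq other_end d | d <- w].

End EmbeddedGraph.


Lemma alternating_neq (T : eqType) (a b : T -> T) n x :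
  involutive a -> involutive b -> (forall y, a y != y) -> (forall y, b y != y) ->
  b (iter n (fun y => a (b y)) x) != x.
Proof.
elim: n a b x => [|n IHn] a b x aK bK aN bN //=.
apply/eqP => /(congr1 b); rewrite bK => e.
have /eqP := IHn b a (b x) bK aK bN aN; apply.
rewrite -{}[RHS]e; congr (a _).
by elim: n {IHn} => //= n ->.
Qed.

Section EmbeddedGraphTheory.
Variable G : embedded_graph.
Implicit Types (x y z : G) (u v : {set G}) (d : {set G}) (w : seq {set G}).

Lemma rho_inj : injective (@rho G).
Proof. by move=> x y /(can_inj (@t1K G)) /(can_inj (@t2K G)). Qed.

Lemma vertex_sym :
  connect_sym [rel y z : G | (z == t1 y) || (z == t2 y)].
Proof.
apply: sym_connect_sym => x y /=; rewrite -(inj_eq (can_inj (@t1K G))) t1K.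
by rewrite -[y == t2 x](inj_eq (can_inj (@t2K G))) t2K ![_ == x]eq_sym.
Qed.

Lemma mem_vertex x : x \in vertex x.
Proof. by rewrite inE connect0. Qed.

Lemma vertex_eq x y : y \in vertex x -> vertex y = vertex x.
Proof.
rewrite inE => xy; apply/setP => z; rewrite !inE.
by rewrite (same_connect vertex_sym xy).
Qed.

Lemma vertex_t1 x : vertex (t1 x) = vertex x.
Proof. by apply: vertex_eq; rewrite inE connect1 //= eqxx. Qed.

Lemma vertex_t2 x : vertex (t2 x) = vertex x.
Proof. by apply: vertex_eq; rewrite inE connect1 //= eqxx orbT. Qed.

Lemma vertex_rho x : vertex (rho x) = vertex x.
Proof. by rewrite /rho vertex_t1 vertex_t2. Qed.

Lemma vertex_in x : vertex x \in vertices G.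
Proof. exact: imset_f. Qed.

Lemma edge_end_t2 x : edge_end (t2 x) = edge_end x.
Proof. by rewrite /edge_end t2K setUC. Qed.

Lemma edge_endP x y : reflect (x = y \/ x = t2 y) (edge_end x == edge_end y).
Proof.
apply: (iffP eqP) => [/setP/(_ x)|[->|->]]; rewrite ?edge_end_t2 //.
by rewrite !inE eqxx /= => /esym/orP[]/eqP; [left | right].
Qed.

Lemma other_end_edge_end x : other_end (edge_end x) = edge_end (t0 x).
Proof. by rewrite /other_end /edge_end imsetU1 imset_set1 t02C. Qed.

Lemma origin_edge_end x : origin (edge_end x) = vertex x.
Proof. by rewrite /origin /edge_end bigcup_setU !big_set1 vertex_t2 setUid. Qed.

Lemma mem_vertexE x y :
  (y \in vertex x) = fconnect (@rho G) x y || fconnect (@rho G) x (t2 y).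
Proof.
have Cs := fconnect_sym rho_inj.
apply/idP/idP; last first.
  have sub z : fconnect (@rho G) x z -> vertex z = vertex x.
    by move/iter_findex<-; elim: (findex _ _ _) => //= n <-; rewrite vertex_rho.
  by case/orP=> /sub <-; rewrite ?vertex_t2 mem_vertex.
rewrite inE => xy; pose A := [pred y | fconnect (@rho G) x y
   || fconnect (@rho G) x (t2 y)].
suff cA : closed [rel y z : G | (z == t1 y) || (z == t2 y)] A.
  by have := closed_connect cA xy; rewrite !inE connect0.
apply: (intro_closed vertex_sym) => {xy}y z.
rewrite !inE => /orP[]/eqP-> /orP[] h; apply/orP.
- by right; rewrite (same_fconnect1_r rho_inj) /rho t2K t1K.
- by left; rewrite (same_fconnect1_r rho_inj) in h; rewrite /rho t2K in h.
- by right; rewrite t2K.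
- by left.
Qed.

Lemma fconnect_t2N x y : fconnect (@rho G) x y -> ~~ fconnect (@rho G) x (t2 y).
Proof.
move=> xy; apply/negP => xt; rewrite (same_connect (fconnect_sym rho_inj) xy) in xt.
have := iter_findex xt; set n := findex _ _ _ => /(congr1 (@t2 G)); rewrite t2K.
apply/eqP; apply: (alternating_neq (a := @t1 G) (b := @t2 G)).
- exact: t1K. - exact: t2K. - exact: t1_neq. - exact: t2_neq.
Qed.

Lemma degreeE x : degree (vertex x) = order (@rho G) x.
Proof.
rewrite /degree /order -(card_in_imset (f := @edge_end G)
  (D := fconnect (@rho G) x)) => [|y z]; last first.
  rewrite !inE => xy xz /eqP/edge_endP[//|yz].
  by have := fconnect_t2N xz; rewrite -yz xy.
congr #|pred_of_set _|; apply/setP => d; apply/imsetP/imsetP => -[y xy ->].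
  move: xy; rewrite mem_vertexE => /orP[h|h]; [by exists y | exists (t2 y) => //].
  by rewrite edge_end_t2.
by exists y; rewrite // mem_vertexE; apply/orP; left.
Qed.

Lemma degree4_rho x : degree (vertex x) = 4 -> rho (rho (rho (rho x))) = x.
Proof. by rewrite degreeE => o4; have := iter_order rho_inj x; rewrite o4. Qed.

Lemma degree4_rho2 x : degree (vertex x) = 4 -> rho (rho x) != x.
Proof.
rewrite degreeE => o4; apply/eqP => e.
have := orbit_uniq (@rho G) x; rewrite /orbit o4 /= e.
by rewrite !inE eqxx orbT.
Qed.

End EmbeddedGraphTheory.

Record graph := Graph {
  vert : Type;
  edge : Type;
  joins : edge -> vert -> vert -> Prop
}.

(* A transverse walk and its reverse give the same edge of G_L. *)
Definition GL_edge (G : embedded_graph) (e : seq {set G} -> Prop) : Prop :=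
  exists u v w, transverse_walk u v w /\
    e = (fun w' => w' = w \/ w' = rev_walk w).

Definition GL (G : embedded_graph) : graph :=
  @Graph {v : {set G} | v \in curvature_vertices G} {e | @GL_edge G e}
    (fun e u v => exists2 w, sval e w & transverse_walk (val u) (val v) w).

Section Hat.
Variable G : embedded_graph.
Implicit Types (x y z : G) (v : {set G}).

(* Some edge of G_L, drawn along its walk, arrives at the vertex of x through
   the edge-end of x and leaves it through the transverse edge-end. *)
Definition segment_through x : Prop :=
  exists (e : edge (GL G)) (w : seq {set G}), sval e w /\
    infix [:: edge_end (t0 x); edge_end (rho (rho x))] w.

Definition crossing v : Prop :=
  exists2 x, x \in v & segment_through x /\ segment_through (rho x).

Definition hat_vertex v : bool :=
  (v \in curvature_vertices G) || `[< crossing v >].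

Definition hat_at x : bool := hat_vertex (vertex x).

(* If y is at a vertex of degree 4 then t1 (t2 (t1 y)) = rho (rho (t2 y)) is on
   the edge-end transverse to that of y, on the same side of the line they
   form. *)
Definition straight y : G := t0 (t1 (t2 (t1 y))).

(* Follow the line leaving the vertex of x along the edge of x up to the next
   vertex of the hat graph. *)
Definition hat_next x : G :=
  let s := orbit straight (t0 x) in nth x s (find hat_at s).


Lemma hat_at_t1 x : hat_at (t1 x) = hat_at x.
Proof. by rewrite /hat_at vertex_t1. Qed.

Lemma hat_at_t2 x : hat_at (t2 x) = hat_at x.
Proof. by rewrite /hat_at vertex_t2. Qed.

Definition opp x : G := t1 (t2 (t1 x)).

Lemma oppK : involutive opp.
Proof. by move=> x; rewrite /opp t1K t2K t1K. Qed.

Lemma opp_neq x : opp x != x.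
Proof.
apply/eqP => /(congr1 (@t1 G)); rewrite /opp t1K => /eqP.
exact/negP/t2_neq.
Qed.

Lemma vertex_opp x : vertex (opp x) = vertex x.
Proof. by rewrite /opp vertex_t1 vertex_t2 vertex_t1. Qed.

Lemma hat_at_opp x : hat_at (opp x) = hat_at x.
Proof. by rewrite /hat_at vertex_opp. Qed.

Lemma straightE y : straight y = t0 (opp y). Proof. by []. Qed.

Lemma straight_inj : injective straight.
Proof. by move=> x y /(can_inj (@t0K G)) /(can_inj oppK). Qed.

Lemma opp_t2 x : degree (vertex x) = 4 -> opp (t2 x) = t2 (opp x).
Proof.
move=> /degree4_rho; rewrite /rho => e.
rewrite -[in RHS]e /opp.
by rewrite t1K t2K t1K t2K.
Qed.

Lemma opp_neq2 x : degree (vertex x) = 4 -> opp x != t2 x.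
Proof.
move=> d4; apply/eqP => e.
have /degree4_rho2/eqP : degree (vertex (t2 x)) = 4 by rewrite vertex_t2.
by apply; rewrite /rho t2K.
Qed.

Lemma nth_orbit x y n : n < order straight y ->
  nth x (orbit straight y) n = iter n straight y.
Proof.
move=> lt_n; rewrite (set_nth_default y) ?size_orbit // /orbit.
by rewrite nth_traject.
Qed.

(* First return to a set of flags that is a union of vertices. *)
Lemma first_return (P : pred G) x : (forall y, P (opp y) = P y) -> P x ->
  exists n, [/\ n < order straight (t0 x), P (iter n straight (t0 x))
    & forall m, m < n -> ~~ P (iter m straight (t0 x))].
Proof.
move=> Popp Px; set s := orbit straight (t0 x).
have hs : has P s.
  apply/hasP; exists (opp x); last by rewrite Popp.
  rewrite -fconnect_orbit (fconnect_sym straight_inj).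
  by rewrite -[t0 x](congr1 (@t0 G) (oppK x)) -straightE fconnect1.
have f_lt : find P s < order straight (t0 x) by rewrite -size_orbit -has_find.
exists (find P s); split=> // [|m lt_m]; first by rewrite -(nth_orbit x) ?nth_find.
by rewrite -(nth_orbit x) ?before_find // (ltn_trans lt_m).
Qed.

Lemma hat_nextP x : hat_at x -> exists n,
  [/\ hat_next x = iter n straight (t0 x), hat_at (hat_next x)
    & forall m, m < n -> ~~ hat_at (iter m straight (t0 x))].
Proof.
move=> /(first_return hat_at_opp)[n [n_lt hn hm]]; exists n.
suff -> : hat_next x = iter n straight (t0 x) by [].
rewrite /hat_next; set s := orbit _ _.
have hs : has hat_at s.
  apply/hasP; exists (iter n straight (t0 x)) => //.
  by rewrite -fconnect_orbit fconnect_iter.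
have f_lt : find hat_at s < order straight (t0 x).
  by rewrite -size_orbit -has_find.
have eF : nth x s (find hat_at s) =
   iter (find hat_at s) straight (t0 x) by rewrite nth_orbit.
rewrite eF; congr iter; apply/eqP; rewrite eqn_leq; apply/andP; split.
  rewrite leqNgt; apply/negP => lt_n; have := before_find x lt_n.
  by rewrite nth_orbit // hn.
rewrite leqNgt; apply/negP => /hm; rewrite -eF.
by rewrite nth_find.
Qed.

Lemma hat_next_uniq x n : hat_at x -> hat_at (iter n straight (t0 x)) ->
  (forall m, m < n -> ~~ hat_at (iter m straight (t0 x))) ->
  hat_next x = iter n straight (t0 x).
Proof.
move=> hx hn hm; have [k [e hk hkm]] := hat_nextP hx; rewrite e.
congr iter; apply/eqP; rewrite eqn_leq; apply/andP; split; rewrite leqNgt.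
  by apply/negP => /hkm; rewrite hn.
by apply/negP => /hm; rewrite -e hk.
Qed.

Lemma iter_straight_rev n k x : k <= n ->
  iter k straight (t0 (iter n straight (t0 x))) =
  t0 (iter (n - k) straight (t0 x)).
Proof.
elim: k => [|k IHk] lt_kn; first by rewrite subn0.
rewrite iterS IHk ?(ltnW lt_kn) // -(subnSK lt_kn) iterS.
by rewrite !straightE t0K oppK.
Qed.

Lemma hat_next_at x : hat_at x -> hat_at (hat_next x).
Proof. by case/hat_nextP=> n []. Qed.

Lemma hat_nextK x : hat_at x -> hat_next (hat_next x) = x.
Proof.
move=> hx; have [n [e h hm]] := hat_nextP hx.
have eN : iter n straight (t0 (hat_next x)) = x.
  by rewrite e iter_straight_rev // subnn /= t0K.
rewrite -[RHS]eN; apply: hat_next_uniq => //; first by rewrite eN.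
move=> m lt_m; rewrite e iter_straight_rev ?(ltnW lt_m) //.
rewrite -(subnSK lt_m) iterS straightE t0K hat_at_opp.
by apply: hm; rewrite subnSK // leq_subr.
Qed.

Lemma hat_next_neq x : hat_at x -> hat_next x != x.
Proof.
case/hat_nextP => n [-> _ _].
have := alternating_neq (a := opp) (b := @t0 G) n x oppK (@t0K G) opp_neq (@t0_neq G).
suff -> : iter n straight (t0 x) = t0 (iter n (fun y => opp (t0 y)) x) by [].
by elim: n => //= n ->.
Qed.

Lemma not_hat_degree x : ~~ hat_at x -> degree (vertex x) = 4.
Proof.
rewrite /hat_at /hat_vertex negb_or inE vertex_in /= negbK => /andP[/eqP d4 _].
exact: d4.
Qed.

Lemma iter_straight_t2 n x :
  (forall m, m < n -> ~~ hat_at (iter m straight (t0 x))) ->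
  iter n straight (t0 (t2 x)) = t2 (iter n straight (t0 x)).
Proof.
elim: n => [|n IHn] hm; first by rewrite /= t02C.
rewrite !iterS IHn; last by move=> m /ltnW/hm.
by rewrite !straightE opp_t2 ?t02C // not_hat_degree // hm.
Qed.

Lemma hat_next_t2 x : hat_at x -> hat_next (t2 x) = t2 (hat_next x).
Proof.
move=> hx; have [n [e h hm]] := hat_nextP hx.
rewrite e -iter_straight_t2 //; apply: hat_next_uniq; rewrite ?hat_at_t2 //.
  by rewrite iter_straight_t2 // hat_at_t2 -e.
move=> m lt_m; rewrite iter_straight_t2 ?hat_at_t2 ?hm // => k lt_k.
exact/hm/(ltn_trans lt_k).
Qed.

Lemma hat_next_neq2 x : hat_at x -> hat_next x != t2 x.
Proof.
move=> hx; have [n [-> _ hm]] := hat_nextP hx.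
apply/eqP; move: n x {hx} hm.
have key k x : (forall m, m < k.*2.+1 -> ~~ hat_at (iter m straight (t0 x))) ->
    iter k.*2.+1 straight (t0 x) <> t2 x.
  move=> hm e.
  pose z := iter k straight (t0 x).
  have : opp z = t2 z.
    have e2 : iter k.+1 straight (t0 (iter k.*2.+1 straight (t0 x))) = t0 z.
      by rewrite iter_straight_rev ?ltnS -?addnn ?leq_addr // subSS addnK.
    move: e2; rewrite e iter_straight_t2 => [|m lt_m]; last first.
      by apply: hm; apply: leq_trans lt_m _; rewrite ltnS -addnn leq_addr.
    rewrite iterS -/z straightE -t02C => /(can_inj (@t0K G)) /(congr1 (@t2 G)).
    by rewrite t2K.
  apply/eqP/opp_neq2/not_hat_degree/hm.
  by rewrite ltnS -addnn leq_addr.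
have key2 k x : (forall m, m < k.*2 -> ~~ hat_at (iter m straight (t0 x))) ->
    iter k.*2 straight (t0 x) <> t2 x.
  move=> hm e.
  pose z := iter k straight (t0 x).
  have e2 : iter k straight (t0 (iter k.*2 straight (t0 x))) = t0 z.
    by rewrite iter_straight_rev -?addnn ?leq_addr // addnK.
  move: e2; rewrite e iter_straight_t2 => [|m lt_m]; last first.
    by apply: hm; apply: leq_trans lt_m _; rewrite -addnn leq_addr.
  by move=> /esym/eqP; rewrite -/z (negbTE (t02_neq z)).
move=> n x; rewrite -(odd_double_half n); case: (odd n) => /=.
  exact: key.
exact: key2.
Qed.

(* The flags of the hat graph are the flags of G at its vertices: all the
   edge-ends of G at such a vertex are on edges of G_L, see hat_drawn below. *)
Definition hat_flag : finType := {x : G | hat_at x}.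

Implicit Types p : hat_flag.

Definition hat_t0 p : hat_flag := exist (fun x => hat_at x) _ (hat_next_at (valP p)).

Fact hat_t1_at p : hat_at (t1 (val p)).
Proof. by rewrite hat_at_t1 (valP p). Qed.
Fact hat_t2_at p : hat_at (t2 (val p)).
Proof. by rewrite hat_at_t2 (valP p). Qed.

Definition hat_t1 p : hat_flag := exist (fun x => hat_at x) _ (hat_t1_at p).
Definition hat_t2 p : hat_flag := exist (fun x => hat_at x) _ (hat_t2_at p).

Fact hat_t0K : involutive hat_t0.
Proof. by move=> p; apply: val_inj; rewrite /= hat_nextK ?(valP p). Qed.
Fact hat_t1K : involutive hat_t1.
Proof. by move=> p; apply: val_inj; rewrite /= t1K. Qed.
Fact hat_t2K : involutive hat_t2.
Proof. by move=> p; apply: val_inj; rewrite /= t2K. Qed.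
Fact hat_t0_neq p : hat_t0 p != p.
Proof. by rewrite -val_eqE /= hat_next_neq ?(valP p). Qed.
Fact hat_t1_neq p : hat_t1 p != p.
Proof. by rewrite -val_eqE /= t1_neq. Qed.
Fact hat_t2_neq p : hat_t2 p != p.
Proof. by rewrite -val_eqE /= t2_neq. Qed.
Fact hat_t02C p : hat_t0 (hat_t2 p) = hat_t2 (hat_t0 p).
Proof. by apply: val_inj; rewrite /= hat_next_t2 ?(valP p). Qed.
Fact hat_t02_neq p : hat_t0 p != hat_t2 p.
Proof. by rewrite -val_eqE /= hat_next_neq2 ?(valP p). Qed.

Definition hat_GL : embedded_graph :=
  EmbeddedGraph hat_t0K hat_t1K hat_t2K hat_t0_neq hat_t1_neq hat_t2_neq
    hat_t02C hat_t02_neq.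

Lemma GL_edge_walk u v w : transverse_walk u v w ->
  exists e : edge (GL G), sval e w.
Proof.
move=> tw.
have h : GL_edge (fun w' => w' = w \/ w' = rev_walk w) by exists u, v, w.
by exists (exist (@GL_edge G) _ h); left.
Qed.

Lemma curvature_drawn x : vertex x \in curvature_vertices G ->
  exists u v w, transverse_walk u v w /\ edge_end x \in w.
Proof.
move=> cx.
have [|n [_ hn hm]] :=
  @first_return (fun y => vertex y \in curvature_vertices G) x _ cx.
  by move=> y; rewrite vertex_opp.
pose y i := iter i straight (t0 x).
pose f i := edge_end (t0 (y i)).
exists (vertex x), (vertex (y n)), (f 0 :: [seq f i | i <- iota 1 n]).
split; last by rewrite inE /f /y /= t0K eqxx.
have oth i : other_end (f i) = edge_end (y i) by rewrite other_end_edge_end t0K.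
rewrite /transverse_walk; apply/and5P; split.
- rewrite /= imset_f //=; apply/allP => _ /mapP[i _ ->]; exact: imset_f.
- by rewrite /f /y /= t0K origin_edge_end.
- suff -> : last (f 0) [seq f i | i <- iota 1 n] = f n.
    by rewrite oth origin_edge_end.
  have {2}<- : last 0 (iota 1 n) = n.
    by case: (n) => // k; rewrite -[k.+1]addn1 iotaD last_cat /= addnC.
  by rewrite (last_map f).
- by move: cx; rewrite inE => /andP[].
apply/andP; split; first by move: hn; rewrite inE => /andP[].
have step i : i < n -> transverse (other_end (f i)) (f i.+1).
  move=> /hm; rewrite inE vertex_in /= negbK => d4; rewrite oth.
  apply/existsP; exists (t2 (y i)); rewrite vertex_t2 d4 edge_end_t2 eqxx /=.
  by rewrite /f /y /= straightE t0K /rho t2K.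
apply/(pathP (f 0)) => i; rewrite size_map size_iota => lt_in.
rewrite -[f 0 :: _]/[seq f i | i <- iota 0 n.+1].
rewrite !(nth_map 0) ?size_iota ?nth_iota ?ltnS ?(ltnW lt_in) //.
exact: step.
Qed.

Lemma other_endK : involutive (@other_end G).
Proof.
move=> d; rewrite /other_end -imset_comp -[RHS]imset_id.
by apply: eq_imset => x /=; rewrite t0K.
Qed.

Lemma rev_walkK : involutive (@rev_walk G).
Proof.
by move=> w; rewrite /rev_walk map_rev revK mapK //; apply: other_endK.
Qed.

Lemma GL_edge_rev (e : edge (GL G)) w : sval e w -> sval e (rev_walk w).
Proof.
case: e => _ /= [u [v [w0 [_ ->]]]] [->|->]; first by right.
by left; rewrite rev_walkK.
Qed.

Lemma mem_rev_walk (d : {set G}) w : (d \in rev_walk w) = (other_end d \in w).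
Proof.
rewrite /rev_walk mem_rev -[d in LHS]other_endK mem_map //.
exact: (can_inj other_endK).
Qed.

Lemma infix_transverse u v w (d1 d2 : {set G}) : transverse_walk u v w ->
  infix [:: d1; d2] w -> transverse (other_end d1) d2.
Proof.
case: w => // d w /and5P[_ _ _ _ /andP[_ pw]] /infixP[s [s' e]].
have : sorted (fun d1 d2 => transverse (other_end d1) d2) (d :: w) by [].
rewrite e; case: s {e} => [|a s] /=; first by case/andP.
by rewrite cat_path /= => /and4P[].
Qed.

Lemma segment_degree x : segment_through x -> degree (vertex x) = 4.
Proof.
case=> -[_ /= [u [v [w0 [tw ->]]]]] [w [[->|->] iw]].
  have := infix_transverse tw iw; rewrite other_end_edge_end t0K.
  case/existsP=> y /and3P[/eqP d4 /eqP xy _].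
  by rewrite -[vertex x]origin_edge_end xy origin_edge_end.
have {}iw : infix (rev_walk [:: edge_end (t0 x); edge_end (rho (rho x))]) w0.
  case/infixP: iw => s [s' e]; rewrite -[w0]rev_walkK e /rev_walk.
  apply/infixP; exists (rev_walk s'), (rev_walk s).
  by rewrite !map_cat !rev_cat -!catA.
have := infix_transverse tw iw; rewrite other_endK.
case/existsP=> y /and3P[/eqP d4 /eqP xy _].
by rewrite -vertex_rho -vertex_rho -origin_edge_end xy origin_edge_end.
Qed.

Lemma segment_drawn x : segment_through x ->
  exists (e : edge (GL G)) (w : seq {set G}),
    [/\ sval e w, edge_end x \in w & edge_end (rho (rho x)) \in rev_walk w].
Proof.
case=> e [w [ew iw]]; exists e, (rev_walk w); rewrite rev_walkK.
have sub := mem_infix iw.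
split; [exact: GL_edge_rev | | by apply: sub; rewrite !inE eqxx orbT].
by rewrite mem_rev_walk other_end_edge_end sub // !inE eqxx.
Qed.

(* No edge-end at a vertex of the hat graph is outside the drawing of G_L. *)
Lemma hat_drawn x : hat_at x ->
  exists (e : edge (GL G)) (w : seq {set G}), sval e w /\ edge_end x \in w.
Proof.
case/orP=> [/curvature_drawn[u [v [w [tw xw]]]]|/asboolP[y]].
  by have [e ew] := GL_edge_walk tw; exists e, w.
move=> yx [sy sry]; have d4 := segment_degree sy.
have {yx} : x \in vertex y by rewrite (vertex_eq yx) mem_vertex.
have orb z : fconnect (@rho G) y z -> exists (e : edge (GL G)) (w : seq {set G}),
    sval e w /\ edge_end z \in w.
  rewrite fconnect_orbit /orbit -degreeE d4 /= !inE.
  have [e [w [ew yw ryw]]] := segment_drawn sy.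
  have [e' [w' [ew' yw' ryw']]] := segment_drawn sry.
  case/or4P=> /eqP->; [by exists e, w | by exists e', w' | |].
    by exists e, (rev_walk w); split=> //; apply: GL_edge_rev.
  by exists e', (rev_walk w'); split=> //; apply: GL_edge_rev.
by rewrite mem_vertexE => /orP[] /orb; rewrite ?edge_end_t2.
Qed.

End Hat.

(* The classification of closed surfaces: the sphere with g handles, or the
   sphere with k + 1 crosscaps. *)
Inductive closed_surface := Orientable (g : nat) | Nonorientable (k : nat).

Definition surface_euler (S : closed_surface) : int :=
  match S with
  | Orientable g => (2%:Z - (2 * g)%:Z)%R
  | Nonorientable k => (2%:Z - k.+1%:Z)%R
  end.

Definition surface_orientable (S : closed_surface) : Prop :=
  if S is Orientable _ then True else False.

(* The surface obtained by gluing a disc on each face boundary is S.  For a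
   graph already drawn in S, such as the hat graph, this holds exactly when the
   drawing is cellular: capping the boundaries of a face that is not an open
   disc increases the Euler characteristic or disconnects the surface. *)
Definition embedded_in (S : closed_surface) (G : embedded_graph) : Prop :=
  [/\ 0 < #|G|, connected_graph G, euler_char G = surface_euler S
    & orientable_graph G <-> surface_orientable S].

Definition is_grid (S : closed_surface) (G : embedded_graph) : Prop :=
  embedded_in S G /\ forall x : G, face_length x = 4.

(* Main.v *)
(* A line of G is either a transverse walk or closed, and only the former are
   drawn in the hat graph.  At a vertex of the hat graph all edge-ends are drawn,
   and two drawn lines meet only at such vertices.  Hence from a corner x of a
   face of the hat graph, whose two sides have lengths a and b, the lines of G
   leaving the interior of the sides are closed, so they never meet a curvature
   vertex and they cut out an a x b rectangle of quadrangles of G; its other two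
   sides are drawn too, so that the face is exactly this rectangle.  Every flag
   of G lies in the rectangle of a unique corner, and this retraction from the
   flags of G to those of the hat graph transfers connectedness and
   orientability.  Finally the Euler characteristic of a quadrangulation is the
   sum of 1 - deg(v) / 4 over its vertices, to which only curvature vertices
   contribute. *)

Require Import Defs.
From mathcomp Require Import all_boot all_order all_algebra.
From mathcomp Require Import boolp zify.

Set Implicit Arguments.
Unset Strict Implicit.
Unset Printing Implicit Defensive.

Local Notation opp := Defs.opp.

Lemma iter_inj (T : Type) (f : T -> T) n : injective f -> injective (iter n f).
Proof. by move=> f_inj; elim: n => //= n IHn x y /f_inj/IHn. Qed.

(** * Drawn edges and how they continue through vertices of degree 4 *)

Section Drawn.
Variable G : embedded_graph.
Implicit Types (x y z : G) (d : {set G}).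

Definition drawn x : bool :=
  `[< exists (e : edge (GL G)) (w : seq {set G}), sval e w /\ edge_end x \in w >].

Lemma drawn_t0_imp x : drawn x -> drawn (t0 x).
Proof.
move=> /asboolP[e [w [ew xw]]]; apply/asboolP; exists e, (rev_walk w).
split; first exact: GL_edge_rev.
by rewrite mem_rev_walk other_end_edge_end t0K.
Qed.

Lemma drawn_t0 x : drawn (t0 x) = drawn x.
Proof. by apply/idP/idP => /drawn_t0_imp //; rewrite t0K. Qed.

Lemma hat_at_drawn x : hat_at x -> drawn x.
Proof. by move=> hx; apply/asboolP; exact: hat_drawn. Qed.

Lemma edge_end_opp_t2 x : degree (vertex x) = 4 ->
  edge_end (opp (t2 x)) = edge_end (opp x).
Proof. by move=> d4; rewrite opp_t2 // edge_end_t2. Qed.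

Lemma edge_end_rho2 x : degree (vertex x) = 4 ->
  edge_end (rho (rho x)) = edge_end (opp x).
Proof. exact: edge_end_opp_t2. Qed.

Lemma edge_end_opp_eq x y : degree (vertex y) = 4 ->
  edge_end x = edge_end y -> edge_end (opp x) = edge_end (opp y).
Proof. by move=> d4 /eqP/edge_endP[->|->] //; apply: edge_end_opp_t2. Qed.

Lemma transverse_opp x d : transverse (edge_end x) d -> d = edge_end (opp x).
Proof.
case/existsP=> y /and3P[/eqP d4 /eqP xy /eqP ->]; rewrite edge_end_rho2 //.
by rewrite (edge_end_opp_eq d4 xy).
Qed.

Lemma opp_transverse x d : transverse d (edge_end x) -> d = edge_end (opp x).
Proof.
case/existsP=> y /and3P[/eqP d4 /eqP -> /eqP]; rewrite edge_end_rho2 // => xy.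
by rewrite (edge_end_opp_eq _ xy) ?vertex_opp // oppK.
Qed.

(** A transverse walk starts outside the vertices of degree 4, so an edge entered at such a vertex
    has a predecessor, and transversality determines it. *)
Lemma walk_pred u v w x : transverse_walk u v w -> edge_end x \in w ->
  degree (vertex x) = 4 -> infix [:: edge_end (t0 (opp x)); edge_end x] w.
Proof.
move=> tw xw d4; case/path.splitPr: xw tw => s1 s2.
case/lastP: s1 => [|s d1] tw.
  by case/and5P: tw => _ /eqP ->; rewrite origin_edge_end d4.
have iw : infix [:: d1; edge_end x] (rcons s d1 ++ edge_end x :: s2).
  by apply/infixP; exists s, s2; rewrite cat_rcons.
have /opp_transverse/(congr1 (@other_end G)) := infix_transverse tw iw.
by rewrite other_endK other_end_edge_end => <-.
Qed.

Lemma walk_succ u v w x : transverse_walk u v w -> edge_end (t0 x) \in w ->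
  degree (vertex x) = 4 -> infix [:: edge_end (t0 x); edge_end (opp x)] w.
Proof.
move=> tw xw d4; case/path.splitPr: xw tw => s1 [|d2 s2] tw.
  exfalso; move: tw; rewrite /transverse_walk; case: s1 => [|d s1].
    case/and5P=> _ _ /eqP -> _.
    by rewrite other_end_edge_end t0K origin_edge_end d4.
  case/and5P=> _ _ /eqP -> _.
  by rewrite last_cat /= other_end_edge_end t0K origin_edge_end d4.
have iw : infix [:: edge_end (t0 x); d2] (s1 ++ edge_end (t0 x) :: d2 :: s2).
  by apply/infixP; exists s1, s2.
have := infix_transverse tw iw; rewrite other_end_edge_end t0K.
by move=> /transverse_opp <-.
Qed.

Lemma infix_rev_walk w1 w2 : infix w1 w2 -> infix (rev_walk w1) (@rev_walk G w2).
Proof.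
move=> /infixP[s [s' ->]]; rewrite /rev_walk !map_cat infix_rev.
by apply/infixP; do 2 eexists.
Qed.

Lemma drawn_segment x : degree (vertex x) = 4 -> drawn x -> segment_through x.
Proof.
(* [w] leaves the vertex of [x] along the edge of [x], whereas a segment has to arrive along it;
   hence the reversed walk. *)
move=> d4 /asboolP[e [w [ew xw]]]; exists e, (rev_walk w).
split; first exact: GL_edge_rev.
rewrite edge_end_rho2 //.
(* Transversality is recorded for [w0] only, and [w] is [w0] or its reverse. *)
case: e ew => _ /= [u [v [w0 [tw ->]]]] /= [ew|ew]; subst w.
  have := infix_rev_walk (walk_pred tw xw d4).
  by rewrite /rev_walk /= /rev /= !other_end_edge_end t0K.
rewrite rev_walkK; apply: walk_succ tw _ d4.
by move: xw; rewrite mem_rev_walk other_end_edge_end.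
Qed.

Lemma drawn_opp x : degree (vertex x) = 4 -> drawn (opp x) = drawn x.
Proof.
have imp y : degree (vertex y) = 4 -> drawn y -> drawn (opp y).
  move=> d4 /(drawn_segment d4)/segment_drawn[e [w [ew _ yw]]].
  apply/asboolP; exists e, (rev_walk w); split; first exact: GL_edge_rev.
  by rewrite -edge_end_rho2.
move=> d4; apply/idP/idP; last exact: imp.
by move=> /imp; rewrite oppK; apply; rewrite vertex_opp.
Qed.

(** At a vertex of degree 4 the two lines are those of [x] and [t1 x]; since [rho x = opp (t1 x)],
    the second also carries [rho x], so two drawn lines cross there. Any other vertex is a curvature
    vertex. *)
Lemma drawn_crossing x : drawn x -> drawn (t1 x) -> hat_at x.
Proof.
move=> dx d1x; rewrite /hat_at /hat_vertex inE vertex_in /=.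
have [d4|//] := eqVneq (degree (vertex x)) 4; apply/asboolP.
exists x; first exact: mem_vertex.
split; first exact: drawn_segment.
apply: drawn_segment; rewrite ?vertex_rho //.
by rewrite -[rho x]/(t1 (t2 x)) -[x in t2 x]t1K -/(opp (t1 x)) drawn_opp ?vertex_t1.
Qed.

End Drawn.

(** * Rectangles of quadrangles bounded by drawn lines *)

Section Rectangles.
Variable G : embedded_graph.
Hypothesis face4 : forall x : G, face_length x = 4.
Implicit Types (x y z : G) (a b i j n : nat).

(** Unit translations of a flag to a neighbouring quadrangle: [right] goes forward along its edge,
    [up] along the other edge of its corner. Conjugation by [t1] exchanges the two. *)
Definition right y : G := opp (t0 y).
Definition up y : G := t1 (right (t1 y)).

Lemma right_inj : injective right.
Proof. by move=> x y /(can_inj (@oppK G))/(can_inj (@t0K G)). Qed.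

Lemma up_inj : injective up.
Proof. by move=> x y /(can_inj (@t1K G))/right_inj/(can_inj (@t1K G)). Qed.

Lemma iter_straightE n x : iter n (@straight G) (t0 x) = t0 (iter n right x).
Proof. by elim: n => //= n ->. Qed.

Lemma t1_iter_right n x : t1 (iter n right x) = iter n up (t1 x).
Proof. by elim: n => //= n <-; rewrite /up t1K. Qed.

Lemma t1_iter_up n x : t1 (iter n up x) = iter n right (t1 x).
Proof. by elim: n => //= n <-; rewrite /up t1K. Qed.

Lemma face4_t1t0 x : t1 (t0 (t1 (t0 (t1 (t0 (t1 (t0 x))))))) = x.
Proof.
have inj : injective (fun y : G => t1 (t0 y)).
  by move=> y z /(can_inj (@t1K G))/(can_inj (@t0K G)).
by have := iter_order inj x; rewrite -/(face_length x) face4.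
Qed.

(** Both words lead to the opposite corner of the quadrangle: they are its half-turn. *)
Lemma face4_swap x : t0 (t1 (t0 (t1 x))) = t1 (t0 (t1 (t0 x))).
Proof. by rewrite -[LHS]face4_t1t0 !(t0K, t1K). Qed.

(** [up x] is [t2 (t1 (t0 (t1 x)))]: it only crosses the side opposite to the edge of [x], and the
    reflection [t0] preserves that side. *)
Lemma t0_up x : t0 (up x) = up (t0 x).
Proof. by rewrite /up /right /opp !t1K t02C face4_swap. Qed.

Lemma t0_iter_up n x : t0 (iter n up x) = iter n up (t0 x).
Proof. by elim: n => //= n <-; rewrite t0_up. Qed.

Lemma iter_right_rev n x : iter n right (t0 (iter n right x)) = t0 x.
Proof.
by elim: n x => //= n IHn x; rewrite -iterS iterSr [right (t0 _)]/right t0K oppK.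
Qed.

Lemma vertex_right x : vertex (right x) = vertex (t0 x).
Proof. by rewrite /right vertex_opp. Qed.

Lemma undrawn_degree x : ~~ drawn x -> degree (vertex x) = 4.
Proof.
by move=> nd; apply: not_hat_degree; apply: contra nd; apply: hat_at_drawn.
Qed.

(* Only lines ending at curvature vertices are drawn, so an undrawn line never
   leaves the vertices of degree 4. *)
Lemma undrawn_right x : ~~ drawn x -> ~~ drawn (right x).
Proof.
rewrite -drawn_t0 => nd; rewrite /right drawn_opp //.
exact: undrawn_degree.
Qed.

Lemma undrawn_iter_right n x : ~~ drawn x -> ~~ drawn (iter n right x).
Proof. by move=> nd; elim: n => //= n; apply: undrawn_right. Qed.

Lemma drawn_right x : ~~ hat_at (right x) -> drawn (right x) = drawn x.
Proof.
rewrite /hat_at vertex_right => /not_hat_degree d4.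
by rewrite /right drawn_opp // drawn_t0.
Qed.

Lemma undrawn_not_hat x : ~~ drawn x -> ~~ hat_at x.
Proof. by apply: contra; apply: hat_at_drawn. Qed.

Lemma undrawn1_not_hat x : ~~ drawn (t1 x) -> ~~ hat_at x.
Proof. by rewrite -hat_at_t1; apply: undrawn_not_hat. Qed.

(** With [z] the opposite corner of the quadrangle of [x], the two sides are [opp (t2 z)] and
    [t2 (opp z)]; these agree when the vertex of [z] has degree 4. *)
Lemma right_up x : ~~ hat_at (right (up x)) -> right (up x) = up (right x).
Proof.
have -> : right (up x) = opp (t2 (t1 (t0 (t1 (t0 x))))).
  by rewrite /right /up /right {2}/opp t1K t02C face4_swap.
have -> : up (right x) = t2 (opp (t1 (t0 (t1 (t0 x))))).
  by rewrite /up /right /opp !t1K t02C.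
by rewrite hat_at_opp hat_at_t2 => /not_hat_degree/opp_t2.
Qed.

Lemma right_up1 x : ~~ hat_at (up (right x)) -> right (up x) = up (right x).
Proof.
move=> nh; apply: (can_inj (@t1K G)); apply/esym.
have := @right_up (t1 x); rewrite -hat_at_t1 /up !t1K in nh *; exact.
Qed.

(** [a] counts the edges of [G] that subdivide the edge of the hat graph leaving along [x]. *)
Definition side x a :=
  [/\ 0 < a, hat_at (iter a right x)
    & forall i, 0 < i < a -> ~~ hat_at (iter i right x)].

(** [hat_next] stops at the far end of the last of the [n.+1] edges, facing back along it: this is
    [t0] after only [n] steps. *)
Lemma side_next x : hat_at x ->
  exists2 n, side x n.+1 & hat_next x = t0 (iter n right x).
Proof.
case/hat_nextP=> n [e hn hm]; exists n; last by rewrite e iter_straightE.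
split=> // [|[|i] //].
  by rewrite iterS /hat_at vertex_right -iter_straightE -e.
by rewrite ltnS => /hm; rewrite iterS /hat_at vertex_right -iter_straightE.
Qed.

Lemma side_uniq x a b : side x a -> side x b -> a = b.
Proof.
move=> [a0 ha na] [b0 hb nb]; case: (ltngtP a b) => // lt.
  by have := nb a; rewrite a0 lt ha => /(_ isT).
by have := na b; rewrite b0 lt hb => /(_ isT).
Qed.

Lemma side_hat_next x a : hat_at x -> side x a ->
  hat_next x = t0 (iter a.-1 right x).
Proof. by move=> /side_next[n sn ->] /(side_uniq sn) <-. Qed.

Lemma side_drawn x a i : hat_at x -> side x a -> i < a -> drawn (iter i right x).
Proof.
move=> hx [_ _ na]; elim: i => [|i IHi] lt_ia; first exact: hat_at_drawn.
by rewrite iterS drawn_right ?IHi ?(ltnW lt_ia) // -iterS na.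
Qed.

(** The side itself is drawn; if the line leaving its interior were drawn too, the two would cross
    at a hat vertex inside the side. *)
Lemma side_undrawn x a i : hat_at x -> side x a -> 0 < i < a ->
  ~~ drawn (t1 (iter i right x)).
Proof.
move=> hx sx /[dup] /(let: And3 _ _ na := sx in na i) nh /andP[_ lt].
by apply: contra nh; apply: drawn_crossing; apply: side_drawn lt.
Qed.

Lemma side_rev x a : hat_at x -> side x a -> side (hat_next x) a.
Proof.
move=> hx sx; rewrite (side_hat_next hx sx); case: sx => a0 ha na.
have E i : i < a -> iter i right (t0 (iter a.-1 right x))
     = t0 (iter (a.-1 - i) right x).
  move=> lt; rewrite -{1}[a.-1](subnKC (n := a.-1) (m := i)); last by lia.
  by rewrite iterD iter_right_rev.
split=> // [|i /andP[i0 lt]].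
  case: a a0 ha na E => // a _ ha na E.
  by rewrite iterS E //= subnn /= /hat_at vertex_right t0K.
rewrite E // /hat_at -vertex_right -iterS; apply: na; lia.
Qed.

Section OneRectangle.
Variables (x : G) (a b : nat).
Hypotheses (hx : hat_at x) (sa : side x a) (sb : side (t1 x) b).

Lemma undrawn_column i j : 0 < i < a -> ~~ drawn (t1 (iter j up (iter i right x))).
Proof.
by move=> ia; rewrite t1_iter_up undrawn_iter_right // (side_undrawn hx sa).
Qed.

Lemma undrawn_row i j : 0 < j < b -> ~~ drawn (iter i right (iter j up x)).
Proof.
move=> jb; rewrite undrawn_iter_right // -[x]t1K -t1_iter_right.
by rewrite (side_undrawn _ sb) // hat_at_t1.
Qed.

(** The last hypothesis excludes only the far corner [(a, b)]. Each step is [right_up] at a vertex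
    with both coordinates positive, which lies on an undrawn column or, when its abscissa is [a], on
    an undrawn row. *)
Lemma commute i j : i <= a -> j <= b -> i + j < a + b ->
  iter i right (iter j up x) = iter j up (iter i right x).
Proof.
elim: i j => [//|i IHi] j; elim: j => [//|j IHj] lia_ ljb lij.
pose y := iter j up (iter i right x).
have Er : iter i.+1 right (iter j.+1 up x) = right (up y).
  by rewrite iterS IHi //; lia.
have Eu : iter j.+1 up (iter i.+1 right x) = up (right y).
  by rewrite iterS -IHj ?iterS ?IHi //; lia.
rewrite Er Eu; have [lt_ia|le_ai] := ltnP i.+1 a.
  apply: right_up1; rewrite -Eu.
  by apply/undrawn1_not_hat/undrawn_column.
by apply: right_up; rewrite -Er; apply/undrawn_not_hat/undrawn_row; lia.
Qed.

Lemma side_opposite : side (t1 (hat_next x)) b.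
Proof.
have [a0 ha na] := sa; have [b0 hb nb] := sb.
rewrite (side_hat_next hx sa).
have E j : t1 (iter j right (t1 (t0 (iter a.-1 right x)))) =
     t0 (iter j up (iter a.-1 right x)).
  by rewrite t1_iter_right t1K t0_iter_up.
have V j z : hat_at (iter j right z) = hat_at (t1 (iter j right z)).
  by rewrite hat_at_t1.
have HT z : hat_at (t0 z) = hat_at (right z) by rewrite /hat_at vertex_right.
have aE y : right (iter a.-1 right y) = iter a right y by rewrite -iterS prednK.
(* Interior vertices of the far side lie on undrawn rows. *)
have nh j : 0 < j < b -> ~~ hat_at (iter j right (t1 (t0 (iter a.-1 right x)))).
  move=> jb; rewrite V E HT -commute; [|lia..].
  by rewrite aE; apply/undrawn_not_hat/undrawn_row.
split=> //.
set x' := t1 _ in nh *.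
have hx' : hat_at x' by rewrite /x' hat_at_t1 HT aE.
have dv j : j < b -> drawn (iter j right x').
  elim: j => [|j IHj] lt; first exact: hat_at_drawn.
  by rewrite iterS drawn_right ?IHj ?(ltnW lt) // -iterS nh.
(* The top line is drawn: it leaves the hat vertex at the end of the left side and then passes only
   vertices on undrawn columns. At the far corner it meets the drawn far side. *)
have dt : drawn (t1 (iter b right x')).
  rewrite E drawn_t0 -commute; [|lia..].
  have : a.-1 < a by rewrite prednK.
  elim: (a.-1) => [|i IHi] lt_ia.
    rewrite /= -[x]t1K -t1_iter_right hat_at_drawn // hat_at_t1.
    exact: hb.
  rewrite iterS drawn_right ?IHi ?(ltnW lt_ia) // -iterS commute; [|lia..].
  by apply/undrawn1_not_hat/undrawn_column.
have [d4|] := eqVneq (degree (vertex (iter b right x'))) 4; last first.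
  by rewrite /hat_at /hat_vertex inE vertex_in /= => ->.
apply: drawn_crossing => //; case: b b0 d4 dv {hb nb nh dt} => // c _ d4 dv.
by rewrite iterS /right drawn_opp ?drawn_t0 ?dv // -vertex_right.
Qed.

End OneRectangle.

(* y is the flag of position (i, j) in the a x b rectangle with corner x. *)
Definition rect x a b i j y :=
  [/\ hat_at x, side x a, side (t1 x) b, i < a /\ j < b
    & y = iter j up (iter i right x)].

Lemma rect_corner x : hat_at x -> exists a b, rect x a b 0 0 x.
Proof.
move=> hx; have [n sa _] := side_next hx.
have [|m sb _] := @side_next (t1 x); first by rewrite hat_at_t1.
by exists n.+1, m.+1.
Qed.

Lemma rect_t1 x a b i j y : rect x a b i j y -> rect (t1 x) b a j i (t1 y).
Proof.
case=> hx sa sb [ia jb] ->; split; rewrite ?t1K ?hat_at_t1 //.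
rewrite t1_iter_up t1_iter_right (@commute (t1 x) b a) ?t1K ?hat_at_t1 //; lia.
Qed.

Lemma rect_t0 x a b i j y : rect x a b i j y ->
  rect (hat_next x) a b (a.-1 - i) j (t0 y).
Proof.
case=> hx sa sb [ia jb] ->; split.
- exact: hat_next_at.
- exact: side_rev.
- exact: side_opposite hx sa sb.
- lia.
rewrite t0_iter_up (side_hat_next hx sa); congr iter.
by rewrite -{2}[a.-1](subnK (n := a.-1) (m := i)) ?iterD ?iter_right_rev //; lia.
Qed.

Lemma iter_right_t2 x a i : side x a -> i < a ->
  iter i right (t2 x) = t2 (iter i right x).
Proof.
case=> _ _ na; elim: i => //= i IHi lt; rewrite IHi ?(ltnW lt) //.
rewrite {1}/right t02C opp_t2 // -vertex_right -iterS.
exact/not_hat_degree/na.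
Qed.

Lemma side_t2 x a : side x a -> side (t2 x) a.
Proof.
move=> sa; have [a0 ha na] := sa.
have E i : 0 < i <= a -> hat_at (iter i right (t2 x)) = hat_at (iter i right x).
  case: i => // i lt; rewrite !iterS (iter_right_t2 sa lt).
  by rewrite /hat_at !vertex_right t02C vertex_t2.
split=> // [|i ia]; first by rewrite E ?a0 /=.
by rewrite E ?na //; lia.
Qed.

(** The bottom side is shared with the rectangle across it, whose height [b'] is unrelated to
    [b]. *)
Lemma rect_t2_bottom x a b i y : rect x a b i 0 y ->
  exists b', rect (t2 x) a b' i 0 (t2 y).
Proof.
case=> hx sa _ [ia _] /= ->; have [|m sb _] := @side_next (t1 (t2 x)).
  by rewrite hat_at_t1 hat_at_t2.
exists m.+1; split; rewrite ?hat_at_t2 //=; first exact: side_t2.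
by rewrite (iter_right_t2 sa).
Qed.

(** Above the bottom row, [t2] undoes one [up] and reflects the flag vertically, so it stays in the
    same rectangle, seen from the upper corner. *)
Lemma rect_t2_inside x a b i j y : rect x a b i j.+1 y ->
  rect (t1 (hat_next (t1 x))) a b i (b.-1 - j) (t2 y).
Proof.
case=> hx sa sb [ia jb] ->.
have -> : t2 (iter j.+1 up (iter i right x)) =
    t1 (t0 (t1 (iter j up (iter i right x)))).
  by rewrite iterS {1}/up /right /opp t1K t2K.
apply/rect_t1/rect_t0/rect_t1; split=> //; lia.
Qed.

Lemma rect_drawn x a b i j y : rect x a b i j y -> drawn y = (j == 0).
Proof.
case=> hx sa sb [ia jb] ->; rewrite -(commute hx sa sb); [|lia..].
case: j jb => [|j] jb; first by rewrite /= (side_drawn hx sa).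
by apply/negbTE/(undrawn_row hx sb).
Qed.

Lemma rect_hat x a b i j y : rect x a b i j y -> hat_at y = (i == 0) && (j == 0).
Proof.
move=> r; have := rect_drawn (rect_t1 r); have := rect_drawn r.
case: i j r => [|i] [|j] r nd nd1.
- by case: r => hx _ _ _ ->.
- by apply/negbTE/undrawn_not_hat; rewrite nd.
- by apply/negbTE/undrawn1_not_hat; rewrite nd1.
- by apply/negbTE/undrawn_not_hat; rewrite nd.
Qed.

(** Cancelling the common [up] steps puts one flag on its bottom row, hence drawn, so the other is
    on its bottom row too. Cancelling the common [right] steps then leaves a corner, which is a hat
    flag and so has abscissa 0 in the other rectangle. *)
Lemma rect_uniq x a b i j x' a' b' i' j' y :
  rect x a b i j y -> rect x' a' b' i' j' y -> x = x'.
Proof.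
wlog le_jj : x a b i j x' a' b' i' j' / j <= j'.
  by move=> W r r'; case/orP: (leq_total j j') => /W; [|move=> H; apply/esym]; eauto.
move=> [hx sa sb [ia jb] ->] [hx' sa' sb' [ia' jb']].
rewrite -(subnKC le_jj) iterD => /(iter_inj up_inj) e.
have r1 : rect x a b i 0 (iter i right x) by split=> //; lia.
have r2 : rect x' a' b' i' (j' - j) (iter i right x) by split=> //; lia.
have := rect_drawn r2; rewrite (rect_drawn r1) => /esym/eqP j0.
rewrite j0 /= in e => {r1 r2 jb jb' le_jj j0}.
wlog le_ii : x a b i x' a' b' i' hx sa sb hx' sa' sb' ia ia' e / i <= i'.
  move=> W; case/orP: (leq_total i i') => l; first by eapply W; eauto.
  by apply/esym; eapply W; eauto.
move: e; rewrite -(subnKC le_ii) iterD => /(iter_inj right_inj) e.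
have r2 : rect x' a' b' (i' - i) 0 x.
  by split=> //; case: sb' => *; lia.
have := rect_hat r2; rewrite hx andbT => /esym/eqP i0.
by rewrite e i0.
Qed.

End Rectangles.

(** * The retraction onto the hat graph: connectedness, orientability, faces *)

Section Hat.
Variable G : embedded_graph.
Hypothesis face4 : forall x : G, face_length x = 4.
Implicit Types (y z : G) (p q : hat_GL G) (a b i j n : nat).

Definition in_rect p y := exists a b i j, rect (val p) a b i j y.

Lemma in_rect_corner p : in_rect p (val p).
Proof. by have [a [b r]] := rect_corner (valP p); exists a, b, 0, 0. Qed.

Lemma in_rect_t0 p y : in_rect p y -> in_rect (t0 p) (t0 y).
Proof. by move=> [a [b [i [j r]]]]; exists a, b, (a.-1 - i), j; apply: rect_t0. Qed.

Lemma in_rect_t1 p y : in_rect p y -> in_rect (t1 p) (t1 y).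
Proof. by move=> [a [b [i [j r]]]]; exists b, a, j, i; apply: rect_t1. Qed.

(** Either a drawn side is crossed, or the rectangle is kept and reflected by [t1 t0 t1]. Both words
    have odd length, as orientability requires. *)
Lemma in_rect_t2 p y : in_rect p y ->
  in_rect (t2 p) (t2 y) \/ in_rect (t1 (t0 (t1 p))) (t2 y).
Proof.
move=> [a [b [i [[|j] r]]]]; [left | right].
  by have [b' r'] := rect_t2_bottom r; exists a, b', i, 0.
by exists a, b, i, (b.-1 - j); apply: rect_t2_inside.
Qed.

Lemma in_rect_uniq p q y : in_rect p y -> in_rect q y -> p = q.
Proof.
move=> [a [b [i [j r]]]] [a' [b' [i' [j' r']]]]; apply: val_inj.
exact: (rect_uniq face4 r r').
Qed.

Definition flag_adj (H : embedded_graph) : rel H :=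
  [rel y z | [|| z == t0 y, z == t1 y | z == t2 y]].

Lemma in_rect_connect p y :
  connect (@flag_adj G) (val p) y ->
  exists2 q, connect (@flag_adj (hat_GL G)) p q
    & in_rect q y.
Proof.
case/connectP=> s; elim/last_ind: s y => [|s y' IHs] y.
  by move=> _ ->; exists p; rewrite ?connect0 //; apply: in_rect_corner.
rewrite rcons_path last_rcons => /andP[/IHs/(_ erefl)[q pq rq] e ->] {y}.
have c0 r : connect (@flag_adj (hat_GL G)) r (t0 r).
  by rewrite connect1 // /flag_adj /= eqxx.
have c1 r : connect (@flag_adj (hat_GL G)) r (t1 r).
  by rewrite connect1 // /flag_adj /= eqxx orbT.
have c2 r : connect (@flag_adj (hat_GL G)) r (t2 r).
  by rewrite connect1 // /flag_adj /= eqxx !orbT.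
case/or3P: e => /eqP ->.
- by exists (t0 q); [apply: connect_trans pq _ | apply: in_rect_t0].
- by exists (t1 q); [apply: connect_trans pq _ | apply: in_rect_t1].
have [r2|r2] := in_rect_t2 rq.
  by exists (t2 q) => //; apply: connect_trans pq _.
exists (t1 (t0 (t1 q))) => //.
apply: connect_trans pq (connect_trans (c1 _) _).
exact: connect_trans (c0 _) (c1 _).
Qed.

Lemma hat_connected : connected_graph G -> connected_graph (hat_GL G).
Proof.
move=> cG p q; have [q' pq' rq'] := in_rect_connect (cG (val p) (val q)).
by rewrite (in_rect_uniq (in_rect_corner q) rq').
Qed.

Lemma orientable_hat : orientable_graph G -> orientable_graph (hat_GL G).
Proof.
move=> [c cP]; exists (fun p => c (val p)) => p /=.
have c0 y : c (t0 y) = ~~ c y by case: (cP y).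
have c1 y : c (t1 y) = ~~ c y by case: (cP y).
have c2 y : c (t2 y) = ~~ c y by case: (cP y).
split=> //; have [n _ ->] := side_next (valP p).
rewrite c0; congr negb.
(* [right] is a word of four flag changes, so it preserves the colour. *)
by elim: n => //= n <-; rewrite /right /opp c1 c2 c1 c0 !negbK.
Qed.

Lemma hat_orientable p : connected_graph G ->
  orientable_graph (hat_GL G) -> orientable_graph G.
Proof.
move=> cG [c cP].
(* Every flag is joined to the corner [p], hence lies in some rectangle; [r] is the retraction,
   along which the colouring is pulled back. *)
have /choice[r rP] : forall y, exists q, in_rect q y.
  by move=> y; have [q _ rq] := in_rect_connect (cG (val p) y); exists q.
exists (fun y => c (r y)) => y; have [E0 E1 E2] := cP (r y); split.
- by rewrite (in_rect_uniq (rP (t0 y)) (in_rect_t0 (rP y))).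
- by rewrite (in_rect_uniq (rP (t1 y)) (in_rect_t1 (rP y))).
have [r2|r2] := in_rect_t2 (rP y); rewrite (in_rect_uniq (rP (t2 y)) r2) //.
have [_ -> _] := cP (t0 (t1 (r y))); have [-> _ _] := cP (t1 (r y)).
by rewrite E1 !negbK.
Qed.

Lemma face4_neq z : t1 (t0 (t1 (t0 z))) != z.
Proof.
apply/eqP => e; have := face4 z; rewrite /face_length => o4.
have := orbit_uniq (fun y : G => t1 (t0 y)) z.
by rewrite /orbit o4 /= e !inE eqxx orbT.
Qed.

(* A symmetry of the rectangle by a half-turn would fix its centre, which is
   the centre of a face, the midpoint of an edge or a vertex of degree 4. *)
Lemma hat_face2_neq p : t1 (t0 (t1 (t0 p))) != p.
Proof.
apply/eqP => e; have [a [b [hx sa sb [a0 b0] _]]] := rect_corner (valP p).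
(* [z] is a flag of a quadrangle that touches the centre of the rectangle. *)
pose i := a.-1./2; pose j := b.-1./2.
have ia : i < a by rewrite /i; lia.
have jb : j < b by rewrite /j; lia.
pose z := iter j (@up G) (iter i (@right G) (val p)).
have r : rect (val p) a b i j z by [].
have r' := rect_t1 face4 (rect_t0 face4 (rect_t1 face4 (rect_t0 face4 r))).
have {e} ev : t1 (hat_next (t1 (hat_next (val p)))) = val p by rewrite -[in RHS]e.
rewrite ev in r'; case: r' => _ _ _ _.
(* The half-turn displaces [z] by at most one step in each direction, according to the parities of
   the sides. *)
have -> : a.-1 - i = i + odd a.-1 by rewrite /i; have := odd_double_half a.-1; lia.
have -> : b.-1 - j = j + odd b.-1 by rewrite /j; have := odd_double_half b.-1; lia.
have C : odd a.-1 -> iter j (@up G) (iter i.+1 (@right G) (val p)) = right z.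
  move=> o; have lt : i.+1 < a by rewrite /i; have := odd_double_half a.-1; lia.
  by rewrite -(commute face4 hx sa sb) ?iterS ?(commute face4 hx sa sb) //; lia.
case oa: (odd a.-1); case ob: (odd b.-1); rewrite ?addn1 ?addn0.
(* The four cases in order: the centre is a vertex of degree 4, the midpoint of an edge (twice), the
   centre of a face. *)
- rewrite iterS C // => e.
  have lta : i.+1 < a by rewrite /i; have := odd_double_half a.-1; lia.
  have ltb : j.+1 < b by rewrite /j; have := odd_double_half b.-1; lia.
  have r2 : rect (val p) a b i.+1 j.+1 (up (right z)) by rewrite -C.
  have /not_hat_degree d4 : ~~ hat_at (up (right z)) by rewrite (rect_hat face4 r2).
  have := @opp_neq2 G (t0 (t1 (t0 z))); rewrite -vertex_t1 e d4 => /(_ erefl)/eqP.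
  apply; move: e; rewrite /up /right /opp !t1K t02C => ->.
  by rewrite t2K t1K.
- rewrite C // /right /opp => /(can_inj (@t1K G)) /eqP.
  exact/negP/t02_neq.
- rewrite iterS -/z -(face4_swap face4) /up /right /opp t1K => /eqP.
  exact/negP/t02_neq.
by move=> /eqP; apply/negP/face4_neq.
Qed.

Lemma order4 (T : finType) (f : T -> T) (x : T) :
  f (f (f (f x))) = x -> f (f x) != x -> order f x = 4.
Proof.
move=> f4 f2; pose s := [:: x; f x; f (f x); f (f (f x))].
have f1 : f x != x by apply: contraNneq f2 => e; rewrite !e.
apply: (@order_cycle _ _ s); rewrite ?inE ?eqxx //= ?f4 ?eqxx //.
have n2 : f x != f (f x) by apply: contraNneq f1 => e; rewrite -{2}f4 -!e.
rewrite !inE !negb_or andbT; apply/and3P; split.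
- apply/and3P; split; rewrite eq_sym //.
  by apply: contraNneq f1 => e; rewrite -{1}e f4.
- rewrite n2 /=; apply: contraNneq f2 => e.
  by rewrite -{2}f4 -e.
by apply: contraNneq f2 => e; rewrite -{2}f4 -e -e.
Qed.

(** Four turns return [val p] to itself in [G], so it lies in the rectangles of both [p] and its
    image after four turns, which are then equal. *)
Lemma hat_face4 p : face_length p = 4.
Proof.
apply: order4; last exact: hat_face2_neq.
apply: (@in_rect_uniq _ _ (val p)); last exact: in_rect_corner.
rewrite -(face4_t1t0 face4 (val p)).
by do 4 apply/in_rect_t1/in_rect_t0; apply: in_rect_corner.
Qed.

End Hat.

(** * The Euler characteristic as a sum over flags *)

Section Euler.
Import GRing.Theory Num.Theory.
Local Open Scope ring_scope.

Lemma cell_sym (T : finType) (a b : T -> T) : involutive a -> involutive b ->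
  connect_sym [rel y z | (z == a y) || (z == b y)].
Proof.
move=> aK bK; apply: sym_connect_sym => x y /=.
rewrite -(inj_eq (can_inj aK)) aK.
by rewrite -[y == b x](inj_eq (can_inj bK)) bK ![_ == x]eq_sym.
Qed.

Lemma cellC (T : finType) (a b : T -> T) x : cell a b x = cell b a x.
Proof.
by apply/setP => y; rewrite !inE; apply: eq_connect => u v /=; rewrite orbC.
Qed.

Lemma mem_cellE (T : finType) (a b : T -> T) x y :
  involutive a -> involutive b ->
  (y \in cell a b x) = fconnect (fun z => a (b z)) x y
                    || fconnect (fun z => a (b z)) x (b y).
Proof.
move=> aK bK; set r := fun z => a (b z).
have r_inj : injective r := inj_comp (can_inj aK) (can_inj bK).
have ca u z : connect [rel y z | (z == a y) || (z == b y)] u z ->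
    connect [rel y z | (z == a y) || (z == b y)] u (a z).
  by move=> c; apply: connect_trans c (connect1 _); rewrite /= eqxx.
have cb u z : connect [rel y z | (z == a y) || (z == b y)] u z ->
    connect [rel y z | (z == a y) || (z == b y)] u (b z).
  by move=> c; apply: connect_trans c (connect1 _); rewrite /= eqxx orbT.
rewrite inE; apply/idP/idP => [xy|]; last first.
  have sub z : fconnect r x z -> connect [rel y z | (z == a y) || (z == b y)] x z.
    by move/iter_findex<-; elim: (findex _ _ _) => //= n IHn; apply/ca/cb.
  by case/orP=> /sub // /cb; rewrite bK.
pose A := [pred y | fconnect r x y || fconnect r x (b y)].
suff cA : closed [rel y z | (z == a y) || (z == b y)] A.
  by have := closed_connect cA xy; rewrite !inE connect0.
apply: (intro_closed (cell_sym aK bK)) => {xy}y z.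
rewrite !inE => /orP[]/eqP-> /orP[] h; apply/orP.
- by right; rewrite (same_fconnect1_r r_inj) /r bK aK.
- by left; rewrite (same_fconnect1_r r_inj) in h; rewrite /r bK in h.
- by right; rewrite bK.
- by left.
Qed.

(** The cell is the orbit of [a \o b] together with its image under [b]; [alternating_neq] makes
    them disjoint. *)
Lemma card_cell (T : finType) (a b : T -> T) x :
  involutive a -> involutive b -> (forall y, a y != y) -> (forall y, b y != y) ->
  #|cell a b x| = (order (fun z => a (b z)) x).*2.
Proof.
move=> aK bK aN bN; set r := fun z => a (b z).
have r_inj : injective r := inj_comp (can_inj aK) (can_inj bK).
have -> : cell a b x = [set y in fconnect r x] :|: b @: [set y in fconnect r x].
  apply/setP => y; rewrite mem_cellE // !inE; congr orb.
  apply/idP/imsetP => [h|[z]]; first by exists (b y); rewrite ?inE ?bK.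
  by rewrite inE => h ->; rewrite bK.
rewrite cardsU disjoint_setI0 ?cards0 ?subn0; last first.
  rewrite disjoint_subset; apply/subsetP => y; rewrite !inE => xy.
  apply/negP => /imsetP[z]; rewrite inE => xz yz.
  have zy : fconnect r z y by rewrite -(same_connect (fconnect_sym r_inj) xz).
  have := alternating_neq (findex r z y) z aK bK aN bN.
  by rewrite -/r iter_findex // yz bK eqxx.
by rewrite card_imset ?cardsE ?addnn //; apply: can_inj bK.
Qed.

(** Weighting each element by the inverse size of its cell gives every cell total weight 1. *)
Lemma card_cells (T : finType) (a b : T -> T) : involutive a -> involutive b ->
  #|cells a b|%:R = \sum_x (#|cell a b x|%:R)^-1 :> rat.
Proof.
move=> aK bK; have cs := cell_sym aK bK.
rewrite (eq_bigl [in [set: T]]) => [|x]; last by rewrite inE.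
rewrite (partition_big_imset (cell a b)) /=.
have -> : cell a b @: [set: T] = cells a b.
  by apply/setP => A; apply/imsetP/imsetP => -[x _ ->]; exists x; rewrite ?inE.
rewrite -sum1_card natr_sum; apply: eq_bigr => _ /imsetP[y _ ->].
have E x : (cell a b x == cell a b y) = (x \in cell a b y).
  apply/eqP/idP => [<-|]; first by rewrite inE connect0.
  by rewrite inE => xy; apply/setP => z; rewrite !inE (same_connect cs xy).
rewrite (eq_bigl (fun x => x \in cell a b y)) => [|x]; last by rewrite inE E.
rewrite (eq_bigr (fun=> (#|cell a b y|%:R)^-1)) => [|x]; last first.
  by rewrite -E => /eqP ->.
rewrite sumr_const -[RHS]mulr_natr mulVf // pnatr_eq0 -lt0n.
by apply/card_gt0P; exists y; rewrite inE connect0.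
Qed.

(* Vertices of degree 4 contribute nothing to this sum. *)
Lemma grid_euler (G : embedded_graph) : (forall x : G, face_length x = 4%N) ->
  (euler_char G)%:~R =
    \sum_(x : G) (((order (@rho G) x).*2%:R)^-1 - 8%:R^-1) :> rat.
Proof.
move=> face4; rewrite /euler_char rmorphD rmorphB /= -!pmulrn.
rewrite !card_cells; try by [apply: t0K | apply: t1K | apply: t2K].
rewrite -sumrB -big_split /=; apply: eq_bigr => x _.
rewrite [cell (@t0 G) (@t1 G) x]cellC !card_cell;
  try by [apply: t0K | apply: t1K | apply: t2K
         | apply: t0_neq | apply: t1_neq | apply: t2_neq].
have -> : order (fun z : G => t0 (t2 z)) x = 2%N.
  apply: (@order_cycle _ _ [:: x; t0 (t2 x)]); rewrite ?inE ?eqxx //=.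
    by rewrite -t02C t2K t0K !eqxx.
  rewrite inE andbT; apply/eqP => e; have /eqP := t02_neq (t2 x).
  by rewrite -e t2K.
rewrite -[order (fun z : G => t1 (t0 z)) x]/(face_length x) face4.
rewrite -[order (fun z : G => t1 (t2 z)) x]/(order (@rho G) x) -addrA.
(* An edge has 4 flags and a face 8, and -1/4 + 1/8 = -1/8. *)
by congr (_ + _).
Qed.

Lemma order_morph (T U : finType) (g : T -> T) (h : U -> U) (f : T -> U) x :
  injective f -> (forall y, f (g y) = h (f y)) -> order g x = order h (f x).
Proof.
move=> f_inj fg; have fgn n y : f (iter n g y) = iter n h (f y).
  by elim: n => //= n <-.
rewrite /order -(card_imset _ f_inj); apply: eq_card => u.
apply/imsetP/idP => [[y xy ->]|].
  by rewrite -(iter_findex xy) fgn; apply: fconnect_iter.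
move=> xu; exists (iter (findex h (f x) u) g x); first exact: fconnect_iter.
by rewrite fgn iter_findex.
Qed.

(** Flags off the hat graph are at vertices of degree 4 and contribute 1/8 - 1/8. The others are the
    flags of [hat_GL], where [rho] is the restriction of that of [G], so the remaining terms
    coincide. *)
Lemma hat_euler (G : embedded_graph) : (forall x : G, face_length x = 4%N) ->
  euler_char (hat_GL G) = euler_char G.
Proof.
move=> face4; apply: (@intr_inj rat).
rewrite !grid_euler //; last exact: hat_face4.
rewrite [RHS](bigID (@hat_at G)) /= [X in _ + X]big1 ?addr0 => [|x]; last first.
  by move=> /not_hat_degree; rewrite degreeE => ->; rewrite subrr.
rewrite [RHS](big_sub (@hat_at G)) /=; apply: eq_bigr => p _.
by rewrite (@order_morph _ _ (@rho (hat_GL G)) (@rho G) val p val_inj).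
Qed.

End Euler.

Theorem theorem4 (S : closed_surface) (G : embedded_graph)
    (gridG : is_grid S G) (L_nonempty : curvature_sequence G <> [::]) :
  is_grid S (hat_GL G).
Proof.
have [[_ cG eG oG] face4] := gridG.
have [x hx] : exists x : G, hat_at x.
  have : curvature_sequence G != [::] by apply/eqP.
  rewrite /curvature_sequence -has_filter => /hasP[_ /mapP[v vG ->] d4].
  move: vG; rewrite mem_enum => /imsetP[x _ vx]; exists x.
  by rewrite /hat_at /hat_vertex inE vertex_in /= /vertex -vx d4.
pose p : hat_GL G := exist (fun x => hat_at x) x hx.
split; last exact: hat_face4.
split.
- by apply/card_gt0P; exists p.
- exact: hat_connected.
- by rewrite hat_euler.
split=> [/(hat_orientable face4 p cG)/oG //|/oG]; exact: orientable_hat.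
Qed.
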